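(* Let $p$ be a prime with $p\equiv 1\pmod 4$ and $m\ge 1$ an integer. Then $\Gamma(\mathbb{Z}_{p^m})$ is pancyclic if and only if $m=2$.
   Context: For a finite commutative ring $R$ with unity, the zero-divisor graph $\Gamma(R)$ has vertex set the nonzero zero-divisors of $R$, with distinct $x,y$ adjacent iff $xy=0$. A graph of order $N$ is pancyclic if $N\ge 3$ and it contains a cycle of length $k$ for every $3\le k\le N$. *)

(* Defs.v *)
From HB Require Import structures.
From mathcomp Require Import all_boot all_order all_algebra.

Set Implicit Arguments.
Unset Strict Implicit.
Unset Printing Implicit Defensive.

Import GRing.Theory.
Local Open Scope ring_scope.

(* A simple graph on a finite vertex type is given by a symmetric, irreflexive
   adjacency relation. *)

Section Graph.

Variables (V : finType) (adj : rel V).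

(* For k >= 3, a duplicate-free closed adj-walk on k vertices is exactly a graph
   cycle of length k. The bound matters: path.cycle also accepts the empty
   sequence, and an edge traversed back and forth when k = 2. *)
Definition has_cycle_of_length (k : nat) : Prop :=
  exists c : seq V, size c = k /\ ucycle adj c.

Definition pancyclic : Prop :=
  (3 <= #|V|)%N /\
  forall k : nat, (3 <= k)%N -> (k <= #|V|)%N -> has_cycle_of_length k.

End Graph.

Section ZeroDivisorGraph.

Variable R : finComNzRingType.

Definition zero_divisor (x : R) : bool := [exists y : R, (y != 0) && (x * y == 0)].

Definition zdg_vertex : finType := {x : R | (x != 0) && zero_divisor x}.

Definition zdg_adj : rel zdg_vertex :=
  fun x y => (x != y) && (val x * val y == 0).

Lemma zdg_adj_sym : symmetric zdg_adj.
Proof. by move=> x y; rewrite /zdg_adj eq_sym mulrC. Qed.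

Lemma zdg_adj_irrefl : irreflexive zdg_adj.
Proof. by move=> x; rewrite /zdg_adj eqxx. Qed.

End ZeroDivisorGraph.

(* Main.v *)
Require Import Defs.
From HB Require Import structures.
From mathcomp Require Import all_boot all_order all_algebra.

(** The vertices are the nonzero multiples of [p].  For [m = 1] there are none;
    for [m = 2] any two of them multiply to zero, so the graph is complete on
    [p - 1 >= 4] vertices.  For [m >= 3] the vertices not divisible by [p ^ 2]
    are independent, and [x |-> x + p] embeds the remaining vertices into them,
    missing [p]; an independent set containing more than half of the vertices
    rules out a Hamiltonian cycle. *)

(** In a duplicate-free sequence consecutive entries differ, and with at least two entries so do the
    last and the first. *)
Lemma complete_ucycle (T : eqType) (e : rel T) (c : seq T) :
  {in c &, forall x y, x != y -> e x y} -> 1 < size c -> uniq c -> ucycle e c.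
Proof.
case: c => // x s e_c s_gt0 Us; apply/andP; split=> //=; rewrite rcons_path.
apply/andP; split.
  have: sorted (fun y z => y != z) (x :: s).
    by apply: pairwise_sorted; rewrite -uniq_pairwise.
  apply: (@sub_in_sorted _ (mem (x :: s)) _ _ _ (x :: s)) => //.
  exact/allP.
have last_s : last x s \in s by case: s s_gt0 {e_c Us} => //= y s _; apply: mem_last.
apply: e_c; rewrite ?mem_head ?mem_last //.
by apply: contraTneq Us => eq_x; rewrite /= -{1}eq_x last_s.
Qed.

(* The successor map of the cycle embeds [A] into its complement. *)
Lemma hamiltonian_independent_card {V : finType} {e : rel V} {c : seq V}
    (A : {set V}) :
  size c = #|V| -> ucycle e c -> {in A &, forall x y, ~~ e x y} ->
  #|A| <= #|~: A|.
Proof.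
move=> sz_c /andP[cyc_c Uc] indepA.
(* A duplicate-free sequence of length [#|V|] visits every vertex. *)
have c_all x : x \in c.
  suff -> : c =i V by [].
  by apply/subset_cardP; [rewrite (card_uniqP Uc) | exact: subset_predT].
rewrite -(card_imset _ (can_inj (prev_next Uc))).
apply/subset_leq_card/subsetP=> _ /imsetP[x Ax ->]; rewrite inE.
by apply: contraL (next_cycle cyc_c (c_all x)) => Ay; apply: indepA.
Qed.

Section ZeroDivisorsZp.

Variables (p m : nat).
Hypotheses (p_prime : prime p) (m_gt0 : 0 < m).

Local Notation R := 'Z_(p ^ m).
Local Notation V := (zdg_vertex R).

(** ['Z_n] is defined as ['I_(Zp_trunc n).+2], whose modulus is [n] only when [1 < n]. *)
Lemma pX_gt1 : 1 < p ^ m.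
Proof. by rewrite -(exp1n m) ltn_exp2r ?prime_gt1. Qed.

Lemma val_Zp_add (x y : R) : ((x + y)%R : R) = (x + y) %% (p ^ m) :> nat.
Proof. by rewrite /= [X in _ %% X](Zp_cast pX_gt1). Qed.

Lemma Zp_mul_eq0 (x y : R) : (x * y == 0)%R = (p ^ m %| x * y).
Proof. by rewrite -val_eqE /= [X in _ %% X](Zp_cast pX_gt1). Qed.

Lemma Zp_eq0 (x : R) : (x == 0)%R = (p ^ m %| x).
Proof.
have := ltn_ord x; rewrite [X in _ < X](Zp_cast pX_gt1) => x_lt.
by rewrite -val_eqE /= /dvdn modn_small.
Qed.

Lemma val_Zp_nat a : (a%:R : R)%R = a %% p ^ m :> nat.
Proof. exact/val_Zp_nat/pX_gt1. Qed.

Lemma dvdp_modn k a : k <= m -> (p ^ k %| a %% p ^ m) = (p ^ k %| a).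
Proof. by move=> le_km; rewrite /dvdn modn_dvdm // dvdn_exp2l. Qed.

Lemma zdg_vertexE (x : R) :
  ((x != 0) && zero_divisor x)%R = ~~ (p ^ m %| x) && (p %| x).
Proof.
rewrite Zp_eq0; congr (_ && _); apply/existsP/idP.
  case=> y /andP[]; rewrite Zp_eq0 Zp_mul_eq0 => yN dvd_xy.
  apply: contraR yN => p_x; move: dvd_xy.
  by rewrite Gauss_dvdr // coprimeXl // prime_coprime.
(* The class of [p ^ m.-1] is nonzero and annihilates every multiple of [p]. *)
case/dvdnP=> a def_x; exists (p ^ m.-1)%:R%R.
have small : p ^ m.-1 < p ^ m by rewrite ltn_exp2l ?prime_gt1 ?prednK.
rewrite Zp_eq0 Zp_mul_eq0 val_Zp_nat modn_small // def_x -mulnA -expnS.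
rewrite prednK // dvdn_mull // andbT gtnNdvd //.
by rewrite expn_gt0 prime_gt0.
Qed.

Lemma vertex_dvd (x : V) : p %| val x.
Proof. by have := valP x; rewrite zdg_vertexE => /andP[]. Qed.

Lemma vertex_ndvd (x : V) : ~~ (p ^ m %| val x).
Proof. by have := valP x; rewrite zdg_vertexE => /andP[]. Qed.

(** The bound on [a] keeps [p * a] below the modulus, so it is its own representative. *)
Lemma p_multiple_vertex a :
  0 < a -> a < p ^ m.-1 -> exists x : V, (val x : nat) = p * a.
Proof.
move=> a_gt0 lt_a.
have lt_pa : p * a < p ^ m by rewrite -(prednK m_gt0) expnS ltn_pmul2l ?prime_gt0.
have Pv : (((p * a)%:R : R) != 0 :> R)%R && zero_divisor ((p * a)%:R : R)%R.
  rewrite zdg_vertexE val_Zp_nat modn_small // [p %| _]dvdn_mulr // andbT gtnNdvd //.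
  by rewrite muln_gt0 prime_gt0.
exists (exist (fun x : R => ((x != 0) && zero_divisor x)%R) _ Pv).
by rewrite val_Zp_nat modn_small.
Qed.

(** With [x = a * p] and [y = b * p], a zero product would give [p ^ 3 %| x * y], hence
    [p %| a * b], so [p] would divide [a] or [b]. *)
Lemma indep_not_dvdp2 (x y : V) : 2 < m ->
  ~~ (p ^ 2 %| val x) -> ~~ (p ^ 2 %| val y) -> ~~ zdg_adj x y.
Proof.
move=> m_gt2 xN yN; rewrite /zdg_adj negb_and Zp_mul_eq0; apply/orP; right.
apply/negP=> /(dvdn_trans (dvdn_exp2l p m_gt2)).
have p_gt0 := prime_gt0 p_prime; move: xN yN.
have /dvdnP[a ->] := vertex_dvd x; have /dvdnP[b ->] := vertex_dvd y.
rewrite mulnACA !expnSr expn0 mul1n [p * p * p]mulnC.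
by rewrite !dvdn_pmul2r ?muln_gt0 ?p_gt0 // Euclid_dvdM // => /negPf-> /negPf->.
Qed.

Lemma card_dvdp2_lt : 2 < m ->
  #|~: [set x : V | ~~ (p ^ 2 %| val x)]| < #|[set x : V | ~~ (p ^ 2 %| val x)]|.
Proof.
move=> m_gt2; set A := [set x : V | _]; have m_ge2 := ltnW m_gt2.
have p_gt1 := prime_gt1 p_prime; have p_gt0 := ltnW p_gt1.
have p2Np : ~~ (p ^ 2 %| p) by rewrite gtnNdvd // -{1}(expn1 p) ltn_exp2l.
have lt_p : p < p ^ m by rewrite -{1}(expn1 p) ltn_exp2l // ltnW.
have val_p : (p%:R : R)%R = p :> nat by rewrite val_Zp_nat modn_small.
pose shift (x : R) : R := (x + p%:R)%R.
have shiftN (x : R) : p ^ 2 %| x -> ~~ (p ^ 2 %| shift x).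
  by move=> p2x; rewrite /shift val_Zp_add val_p dvdp_modn // dvdn_addr.
have shift_vertex (x : R) : p ^ 2 %| x -> ((shift x != 0) && zero_divisor (shift x))%R.
  move=> p2x; rewrite zdg_vertexE; apply/andP; split.
    by apply: contra (shiftN x p2x) => /(dvdn_trans (dvdn_exp2l p m_ge2)).
  rewrite /shift val_Zp_add val_p; have := dvdp_modn 1 (x + p) m_gt0.
  by rewrite expn1 => ->; rewrite dvdn_addl // (dvdn_trans _ p2x) // dvdn_exp.
(* The default [x] of [insubd] is never reached on multiples of [p ^ 2], the only vertices where [f]
   is used. *)
pose f (x : V) : V := insubd x (shift (val x)).
have valf (x : V) : p ^ 2 %| val x -> val (f x) = shift (val x).
  by move=> p2x; rewrite val_insubd shift_vertex.
(* The vertex [p] lies in [A] but outside the image of [f], which makes the inequality strict. *)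
have [v0 val_v0] : exists v : V, (val v : nat) = p * 1.
  by apply: p_multiple_vertex => //; rewrite -(expn0 p) ltn_exp2l // -ltnS prednK // ltnW.
rewrite muln1 in val_v0.
have BP (x : V) : x \in ~: A -> p ^ 2 %| val x by rewrite !inE negbK.
have injf : {in ~: A &, injective f}.
  move=> x y /BP Bx /BP By /(congr1 val); rewrite !valf // => /GRing.addIr.
  exact: val_inj.
rewrite -(card_in_imset injf); apply/proper_card/properP; split.
  by apply/subsetP=> _ /imsetP[x /BP Bx ->]; rewrite inE valf ?shiftN.
exists v0; first by rewrite inE val_v0.
apply/imsetP=> -[x /BP Bx def_v0].
have /(congr1 val) := def_v0; rewrite valf // => def_p.
(* Cancelling [p] would give [x = 0], which is not a vertex. *)
have: (0 + p%:R)%R = shift (val x).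
  by rewrite -def_p GRing.add0r; apply: val_inj; rewrite /= val_p.
move=> /GRing.addIr x0; have /andP[] := valP x.
by rewrite -x0 eqxx.
Qed.

End ZeroDivisorsZp.

Theorem theorem2p7 (p m : nat) (p_prime : prime p) (p_mod4 : p = 1 %[mod 4])
    (m_ge1 : 1 <= m) :
  pancyclic (@zdg_adj 'Z_(p ^ m)) <-> m = 2.
Proof.
(* The congruence excludes the primes 2 and 3. *)
have p_gt3 : 3 < p by case: p p_prime p_mod4 => [|[|[|[|p']]]].
split=> [[V_ge3 hamV] | def_m].
  case: (ltngtP m 2) => // [m_lt2 | m_gt2]; last first.
    have [c [sz_c cyc_c]] := hamV _ V_ge3 (leqnn _).
    have := card_dvdp2_lt _ _ p_prime m_ge1 m_gt2; rewrite ltnNge => /negP[].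
    apply: hamiltonian_independent_card sz_c cyc_c _ => x y; rewrite !inE.
    exact: indep_not_dvdp2.
  have m1 : m = 1 by apply/eqP; rewrite eqn_leq -ltnS m_lt2.
  (* For [m = 1] a vertex would be both divisible and not divisible by [p]. *)
  have /card_gt0P[x _] : 0 < #|zdg_vertex 'Z_(p ^ m)| by apply: leq_trans V_ge3.
  have := vertex_ndvd _ _ p_prime m_ge1 x.
  have pm : p ^ m = p by rewrite m1 expn1.
  by rewrite [X in X %| _]pm (vertex_dvd _ _ p_prime m_ge1 x).
split=> [|k k_ge3 k_le].
  (* Since [3 < p], the elements [p], [2p] and [3p] are three distinct vertices. *)
  have ltp a : a < 4 -> a < p ^ m.-1.
    by move=> a4; rewrite def_m expn1 (leq_trans a4).
  have p_gt0 := prime_gt0 p_prime.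
  have [x1 e1] := p_multiple_vertex _ _ p_prime m_ge1 1 isT (ltp 1 isT).
  have [x2 e2] := p_multiple_vertex _ _ p_prime m_ge1 2 isT (ltp 2 isT).
  have [x3 e3] := p_multiple_vertex _ _ p_prime m_ge1 3 isT (ltp 3 isT).
  have U : uniq [:: x1; x2; x3].
    by rewrite /= !inE -!val_eqE /= e1 e2 e3 !eqn_pmul2l.
  exact: leq_trans (eq_leq (esym (card_uniqP U))) (max_card _).
(* In a complete graph any [k] vertices form a cycle; the first [k] in the enumeration serve. *)
have sz_k : size (take k (enum (zdg_vertex 'Z_(p ^ m)))) = k.
  by rewrite size_takel -?cardE.
exists (take k (enum (zdg_vertex 'Z_(p ^ m)))); split=> //.
apply: complete_ucycle => [x y _ _ neq_xy||]; last exact/take_uniq/enum_uniq.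
  have pm : p ^ m = p * p by rewrite def_m mulnn.
  by rewrite /zdg_adj neq_xy Zp_mul_eq0 // [X in X %| _]pm dvdn_mul ?vertex_dvd.
by rewrite sz_k ltnW.
Qed.
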